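(* As formal power series in $q$, \[\sum_{\pi\in\mathcal{D}} (-1)^{\mathcal{E}(\pi)} q^{\mathcal{O}(\pi)+\lfloor\mathcal{E}\rfloor(\pi)} = (-q;q^3)_\infty,\qquad \sum_{\pi\in\mathcal{P}} (-1)^{\mathcal{E}(\pi)} q^{\mathcal{O}(\pi)+\lfloor\mathcal{E}\rfloor(\pi)} = \frac{1}{(q^3;q^3)_\infty}.\]
   Context: A partition $\pi=(\lambda_1,\lambda_2,\dots)$ is a finite non-increasing sequence of positive integers; the empty sequence is the unique partition of $0$. $\mathcal{P}$ is the set of all partitions, $\mathcal{D}$ the set of partitions into distinct parts. $\mathcal{O}(\pi)=\lambda_1+\lambda_3+\cdots$, $\mathcal{E}(\pi)=\lambda_2+\lambda_4+\cdots$, and $\lfloor\mathcal{E}\rfloor(\pi)=\lfloor\lambda_2/2\rfloor+\lfloor\lambda_4/2\rfloor+\cdots$. $(a;q)_\infty=\prod_{i\ge0}(1-aq^i)$. *)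

(* Defs.v *)
From HB Require Import structures.
From mathcomp Require Import all_boot all_order all_algebra.
From mathcomp Require Import all_classical.

Set Implicit Arguments.
Unset Strict Implicit.
Unset Printing Implicit Defensive.

Import GRing.Theory.
Local Open Scope ring_scope.

Record fps (R : Type) := FPS { fcoef : nat -> R }.

HB.instance Definition _ (R : Type) := gen_eqMixin (fps R).
HB.instance Definition _ (R : Type) := gen_choiceMixin (fps R).

Lemma fpsP (R : Type) (f g : fps R) : fcoef f =1 fcoef g <-> f = g.
Proof.
split=> [|-> //]; case: f g => [f] [g] /= fg.
by congr FPS; apply/funext.
Qed.

Section Ring.
Variable R : comUnitRingType.
Implicit Types f g h : fps R.

Definition fps_zero : fps R := FPS (fun=> 0).
Definition fps_opp f : fps R := FPS (fun n => - fcoef f n).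
Definition fps_add f g : fps R := FPS (fun n => fcoef f n + fcoef g n).
Definition fps_one : fps R := FPS (fun n => (n == 0%N)%:R).
Definition fps_mul f g : fps R :=
  FPS (fun n => \sum_(i < n.+1) fcoef f i * fcoef g (n - i)%N).

Fact fps_addA : associative fps_add.
Proof. by move=> f g h; apply/fpsP => n /=; rewrite addrA. Qed.
Fact fps_addC : commutative fps_add.
Proof. by move=> f g; apply/fpsP => n /=; rewrite addrC. Qed.
Fact fps_add0 : left_id fps_zero fps_add.
Proof. by move=> f; apply/fpsP => n /=; rewrite add0r. Qed.
Fact fps_addN : left_inverse fps_zero fps_opp fps_add.
Proof. by move=> f; apply/fpsP => n /=; rewrite addNr. Qed.

HB.instance Definition _ := GRing.isZmodule.Build (fps R)
  fps_addA fps_addC fps_add0 fps_addN.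

Let trunc N f : {poly R} := \poly_(i < N.+1) fcoef f i.

Let coef_trunc N f n : (n <= N)%N -> (trunc N f)`_n = fcoef f n.
Proof. by move=> nN; rewrite coef_poly ltnS nN. Qed.

Let coef_mul_trunc N f g n : (n <= N)%N ->
  fcoef (fps_mul f g) n = (trunc N f * trunc N g)`_n.
Proof.
move=> nN; rewrite coefM; apply: eq_bigr => i _ /=.
have iN : (i <= N)%N by apply: leq_trans nN; rewrite -ltnS.
by rewrite !coef_trunc // (leq_trans (leq_subr _ _)).
Qed.

Fact fps_mulA : associative fps_mul.
Proof.
move=> f g h; apply/fpsP => n.
transitivity ((trunc n f * trunc n g * trunc n h)`_n).
  rewrite -mulrA coefM /=; apply: eq_bigr => i _.
  rewrite coef_trunc -1?ltnS // -(@coef_mul_trunc n) ?leq_subr //.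
rewrite coefM /=; apply: eq_bigr => i _.
by rewrite coef_trunc ?leq_subr // -(@coef_mul_trunc n) // -ltnS.
Qed.

Fact fps_mulC : commutative fps_mul.
Proof.
by move=> f g; apply/fpsP => n; rewrite !(@coef_mul_trunc n) // mulrC.
Qed.

Fact fps_mul1 : left_id fps_one fps_mul.
Proof.
move=> f; apply/fpsP => n /=; rewrite big_ord_recl /= mul1r subn0.
by rewrite big1 ?addr0 // => i _; rewrite mul0r.
Qed.

Fact fps_mulDl : left_distributive fps_mul fps_add.
Proof.
move=> f g h; apply/fpsP => n /=.
by rewrite -big_split; apply: eq_bigr => i _; rewrite mulrDl.
Qed.

Fact fps_one_neq0 : fps_one != fps_zero.
Proof.
by apply/eqP => /fpsP /(_ 0%N) /= /eqP; rewrite oner_eq0.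
Qed.

HB.instance Definition _ := GRing.Zmodule_isComNzRing.Build (fps R)
  fps_mulA fps_mulC fps_mul1 fps_mulDl fps_one_neq0.

Definition fps_unit : {pred fps R} :=
  fun f => fcoef f 0 \is a GRing.unit.

(* [fps_inv_seq f n] lists the coefficients 0, ..., n of the inverse g of f,
   computed from g_0 = f_0^-1 and f_0 g_n = - \sum_(i < n) g_i f_(n-i) *)
Fixpoint fps_inv_seq f (n : nat) : seq R :=
  if n is m.+1 then
    let s := fps_inv_seq f m in
    rcons s (- (fcoef f 0)^-1 * \sum_(i < m.+1) s`_i * fcoef f (m.+1 - i)%N)
  else [:: (fcoef f 0)^-1].

(* following the library's convention, non-units are their own inverse *)
Definition fps_inv f : fps R :=
  if fps_unit f then FPS (fun n => (fps_inv_seq f n)`_n) else f.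

Let size_inv_seq f n : size (fps_inv_seq f n) = n.+1.
Proof. by elim: n => //= n IH; rewrite size_rcons IH. Qed.

Let nth_inv_seq f n i : (i <= n)%N ->
  (fps_inv_seq f n)`_i = (fps_inv_seq f i)`_i.
Proof.
elim: n => [|n IH]; first by rewrite leqn0 => /eqP ->.
rewrite leq_eqVlt => /orP[/eqP -> //|lt_in].
by rewrite [fps_inv_seq f n.+1]/= nth_rcons size_inv_seq lt_in IH.
Qed.

Fact fps_mulVr : {in fps_unit, left_inverse 1 fps_inv *%R}.
Proof.
move=> f uf; have uf0 : fcoef f 0 \is a GRing.unit := uf.
rewrite /fps_inv (uf : fps_unit f); apply/fpsP => -[|n].
  by rewrite /= big_ord1 /= mulVr.
set g := FPS _; have gS : fcoef g n.+1 =
    - (fcoef f 0)^-1 * \sum_(i < n.+1) fcoef g i * fcoef f (n.+1 - i)%N.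
  rewrite /= nth_rcons size_inv_seq ltnn eqxx; congr (_ * _).
  by apply: eq_bigr => i _; rewrite nth_inv_seq // -ltnS.
transitivity (\sum_(i < n.+2) fcoef g i * fcoef f (n.+1 - i)%N) => //.
rewrite big_ord_recr /= subnn -/(fcoef g n.+1).
by rewrite [X in X * _]gS mulNr mulNr mulrAC mulVr // mul1r subrr.
Qed.

Fact fps_unitP f g : g * f = 1 -> fps_unit f.
Proof.
move=> /fpsP /(_ 0%N) /=; rewrite big_ord1 /= => gf1.
by apply/unitrPr; exists (fcoef g 0); rewrite mulrC.
Qed.

Fact fps_inv_out : {in [predC fps_unit], fps_inv =1 id}.
Proof. by move=> f nf; rewrite /fps_inv ifN. Qed.

HB.instance Definition _ := GRing.ComNzRing_hasMulInverse.Build (fps R)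
  fps_mulVr fps_unitP fps_inv_out.

Definition fpsX : fps R := FPS (fun n => (n == 1%N)%:R).

(* convergence for the q-adic topology with discrete coefficients *)
Definition fps_cvg (u : nat -> fps R) (l : fps R) : Prop :=
  forall n, exists K, forall k, (K <= k)%N -> fcoef (u k) n = fcoef l n.

Definition fps_lim (u : nat -> fps R) : fps R := xget 0 (fps_cvg u).

Lemma fps_cvg_unique (u : nat -> fps R) l1 l2 :
  fps_cvg u l1 -> fps_cvg u l2 -> l1 = l2.
Proof.
move=> c1 c2; apply/fpsP => n; have [K1 h1] := c1 n; have [K2 h2] := c2 n.
by rewrite -(h1 (maxn K1 K2)) ?leq_maxl // (h2 (maxn K1 K2)) ?leq_maxr.
Qed.

Definition qpoch_fin (a q : fps R) (n : nat) : fps R :=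
  \prod_(i < n) (1 - a * q ^+ i).

(* (a; q)_oo; see [qpoch_cvg] for the existence of the limit *)
Definition qpoch (a q : fps R) : fps R := fps_lim (qpoch_fin a q).

Let fcoef_mul_lt f g n N : (forall i, (i < N)%N -> fcoef g i = 0) ->
  (n < N)%N -> fcoef (f * g) n = 0.
Proof.
move=> g0 nN; rewrite /= big1 // => i _.
by rewrite g0 ?mulr0 // (leq_ltn_trans (leq_subr _ _)).
Qed.

Let fcoef_exp_lt (q : fps R) N : fcoef q 0 = 0 ->
  forall i, (i < N)%N -> fcoef (q ^+ N) i = 0.
Proof.
move=> q0; elim: N => // N IH i; rewrite ltnS => iN.
rewrite exprS /= big_ord_recl q0 mul0r add0r big1 // => j _.
rewrite IH ?mulr0 // lift0; have := ltn_ord j; case: i iN j => [|i] iN j //=.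
by rewrite subSS => _; apply: leq_ltn_trans (leq_subr _ _) iN.
Qed.

Lemma qpoch_cvg (a q : fps R) :
  fcoef q 0 = 0 -> fps_cvg (qpoch_fin a q) (qpoch a q).
Proof.
move=> q0; suff ex : fps_cvg (qpoch_fin a q)
    (FPS (fun n => fcoef (qpoch_fin a q n.+1) n)).
  by rewrite /qpoch /fps_lim; case: xgetP => [l -> //|/(_ _ ex)].
move=> n; exists n.+1 => k /subnK <-; elim: (k - n.+1)%N => // m IH.
rewrite addSn; set N := (m + n.+1)%N in IH *.
have -> : qpoch_fin a q N.+1 = qpoch_fin a q N - qpoch_fin a q N * a * q ^+ N.
  transitivity (qpoch_fin a q N * (1 - a * q ^+ N)); first exact: big_ord_recr.
  by rewrite mulrBr mulr1 mulrA.
transitivity (fcoef (qpoch_fin a q N) n - fcoef (qpoch_fin a q N * a * q ^+ N) n).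
  by [].
have nN : (n < N)%N by rewrite /N addnS ltnS leq_addl.
by rewrite (fcoef_mul_lt _ (fcoef_exp_lt q0) nN) subr0 IH.
Qed.

Lemma qpoch_unit (a q : fps R) : fcoef a 0 = 0 -> fcoef q 0 = 0 ->
  qpoch a q \is a GRing.unit.
Proof.
move=> a0 q0; have [K /(_ K (leqnn K)) h] := qpoch_cvg a q0 0%N.
suff : fcoef (qpoch a q) 0 = 1.
  by move=> e; apply: (_ : fps_unit _); rewrite /fps_unit e unitr1.
rewrite -h {h}; elim: K => [|k IH]; first by rewrite /qpoch_fin big_ord0.
rewrite /qpoch_fin big_ord_recr /= big_ord1 /= big_ord1 a0 mul0r subr0 mulr1.
exact: IH.
Qed.

(* The family (F x), x in A, is summable (each power of q occurs in finitely
   many of its members) and its sum is S. *)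
Definition fps_has_sum (T : choiceType) (A : set T) (F : T -> fps R)
    (S : fps R) : Prop :=
  forall n, finite_set [set x | A x /\ fcoef (F x) n <> 0] /\
    fcoef S n = \sum_(x \in A) fcoef (F x) n.

End Ring.

Arguments fpsX {R}.

Definition is_partition (s : seq nat) : bool := sorted geq s && (0%N \notin s).

Definition partitions : set (seq nat) := [set s | is_partition s].

Definition distinct_partitions : set (seq nat) :=
  [set s | is_partition s && uniq s].

(* parts are indexed from 0 here: lambda_(i+1) is [nth 0 s i] *)
Definition odd_sum (s : seq nat) : nat :=
  (\sum_(i < size s | ~~ odd i) nth 0 s i)%N.
Definition even_sum (s : seq nat) : nat :=
  (\sum_(i < size s | odd i) nth 0 s i)%N.
Definition even_half_sum (s : seq nat) : nat :=
  (\sum_(i < size s | odd i) (nth 0 s i)./2)%N.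

Definition partition_term (s : seq nat) : fps int :=
  (-1) ^+ even_sum s * fpsX ^+ (odd_sum s + even_half_sum s).

(* Main.v *)
(** Let A_N be the signed generating function of the partitions with parts at
most N, and B_N the same with the roles of odd and even positions exchanged.
Removing a largest part N exchanges positions; hence, for distinct parts,
  A_N = A_{N-1} + q^N B_{N-1},
  B_N = B_{N-1} + (-1)^N q^{floor(N/2)} A_{N-1},
and for unrestricted partitions the same holds with B_N, A_N in place of
B_{N-1}, A_{N-1} in the last terms. In both cases B_N vanishes for N odd and
B_{2k} = q^k A_{2k}, so that A_{2k+1} = A_{2k-1} (1 + q^{3k+1}) in the first
case and A_{2k} = A_{2k+1} = A_{2k-1} / (1 - q^{3k}) in the second. *)

Require Import Defs.
From mathcomp Require Import all_boot all_order all_algebra.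
From mathcomp Require Import all_classical.
From mathcomp Require Import zify ring.

Set Implicit Arguments.
Unset Strict Implicit.
Unset Printing Implicit Defensive.

Import GRing.Theory.
Local Open Scope ring_scope.

(** * Coefficients, inverses and limits of power series *)

Section PowerSeries.
Variable R : comUnitRingType.
Implicit Types (f g : fps R) (n m k : nat).

Lemma fcoefD f g n : fcoef (f + g) n = fcoef f n + fcoef g n.
Proof. by []. Qed.

Lemma fcoefB f g n : fcoef (f - g) n = fcoef f n - fcoef g n.
Proof. by []. Qed.

Lemma fcoefM0 f g : fcoef (f * g) 0 = fcoef f 0 * fcoef g 0.
Proof. by rewrite /= big_ord1. Qed.

Lemma fcoef_sum (I : Type) (r : seq I) (F : I -> fps R) n :
  fcoef (\sum_(i <- r) F i) n = \sum_(i <- r) fcoef (F i) n.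
Proof. by elim/big_rec2: _ => // i y x _ <-. Qed.

Lemma fcoefXM f n : fcoef (fpsX * f) n = if n is m.+1 then fcoef f m else 0.
Proof.
case: n => [|n]; first by rewrite fcoefM0 mul0r.
rewrite /= !big_ord_recl /= mul0r add0r mul1r big1 ?addr0 ?subSS ?subn0 // => i _.
by rewrite mul0r.
Qed.

Lemma fcoefXnM f k n :
  fcoef (fpsX ^+ k * f) n = if (n < k)%N then 0 else fcoef f (n - k).
Proof.
elim: k n => [|k IH] n; first by rewrite mul1r subn0.
by rewrite exprS -mulrA fcoefXM; case: n => // n; rewrite IH ltnS subSS.
Qed.

Lemma fcoefXn k n : fcoef (fpsX ^+ k : fps R) n = (n == k)%:R.
Proof.
rewrite -[fpsX ^+ k]mulr1 fcoefXnM /= subn_eq0 eqn_leq.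
by case: ltnP; rewrite ?andbF ?andbT.
Qed.

Lemma fcoef_signM k f n : fcoef ((-1) ^+ k * f) n = (-1) ^+ k * fcoef f n.
Proof.
rewrite -signr_odd -[in RHS]signr_odd.
by case: (odd k); rewrite ?expr1 ?expr0 ?mulN1r ?mul1r.
Qed.

(** Since f^-1 - g^-1 = (g - f) f^-1 g^-1, its coefficient n involves g - f only up to degree n.
    This makes inversion continuous. *)
Lemma fcoef_inv_eq f g n : f \is a GRing.unit -> g \is a GRing.unit ->
  (forall m, (m <= n)%N -> fcoef f m = fcoef g m) ->
  fcoef f^-1 n = fcoef g^-1 n.
Proof.
move=> uf ug fg; apply/eqP; rewrite -subr_eq0 -fcoefB; apply/eqP.
have -> : f^-1 - g^-1 = (g - f) * (f^-1 * g^-1).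
  by rewrite mulrBl mulrCA mulrV // mulr1 [f * _]mulrA mulrV // mul1r.
rewrite {1}/GRing.mul /= big1 // => i _.
by rewrite fg ?subrr ?mul0r // -ltnS.
Qed.

(** Coefficient n of an inverse depends on all lower ones, so a single rank K must serve for all of
    them. *)
Lemma fps_cvg_le u (l : fps R) n : fps_cvg u l ->
  exists K, forall k m, (K <= k)%N -> (m <= n)%N -> fcoef (u k) m = fcoef l m.
Proof.
move=> ul; elim: n => [|n [K IH]].
  by have [K h] := ul 0%N; exists K => k m ?; rewrite leqn0 => /eqP->; apply: h.
have [K' h] := ul n.+1; exists (maxn K K') => k m.
rewrite geq_max => /andP[Kk K'k]; rewrite leq_eqVlt ltnS => /orP[/eqP->|].
  exact: h.
exact: IH.
Qed.

Lemma qpoch_finS (a q : fps R) k :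
  qpoch_fin a q k.+1 = qpoch_fin a q k * (1 - a * q ^+ k).
Proof. exact: big_ord_recr. Qed.

Lemma qpoch_fin0 (a q : fps R) : qpoch_fin a q 0 = 1.
Proof. exact: big_ord0. Qed.

Lemma fcoef0_qpoch_fin (a q : fps R) k :
  fcoef a 0 = 0 -> fcoef (qpoch_fin a q k) 0 = 1.
Proof.
move=> a0; elim: k => [|k IH]; first by rewrite qpoch_fin0.
by rewrite qpoch_finS fcoefM0 IH mul1r fcoefB fcoefM0 a0 mul0r subr0.
Qed.

Lemma fps_unitE f : (f \is a GRing.unit) = (fcoef f 0 \is a GRing.unit).
Proof. by []. Qed.

Lemma qpoch_fin_unit (a q : fps R) k :
  fcoef a 0 = 0 -> qpoch_fin a q k \is a GRing.unit.
Proof. by move=> a0; rewrite fps_unitE fcoef0_qpoch_fin // unitr1. Qed.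

Lemma qpochV_cvg (a q : fps R) : fcoef a 0 = 0 -> fcoef q 0 = 0 ->
  fps_cvg (fun k => (qpoch_fin a q k)^-1) (qpoch a q)^-1.
Proof.
move=> a0 q0 n; have [K h] := @fps_cvg_le _ _ n (qpoch_cvg a q0).
exists K => k Kk; apply: fcoef_inv_eq => [||m]; last exact: h.
  exact: qpoch_fin_unit.
exact: qpoch_unit.
Qed.

Lemma fps_has_sum_seq (T : choiceType) (A : set T) (F : T -> fps R) (S : fps R) :
  (forall n, exists r : seq T, [/\ uniq r, {in r, forall x, A x},
     (forall x, A x -> fcoef (F x) n <> 0 -> x \in r) &
     fcoef (\sum_(x <- r) F x) n = fcoef S n]) ->
  fps_has_sum A F S.
Proof.
move=> h n; have [r [Ur rA Ar rS]] := h n; split.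
  by apply: sub_finite_set (finite_seq r) => x [Ax nz]; apply: Ar.
rewrite -rS fcoef_sum (fsbigE r) // => [|x Ax xr]; last first.
  by apply: contra_notP (negP xr) => /(Ar x Ax).
rewrite big_seq [RHS]big_mkcond big_seq; apply: eq_bigr => x /rA Ax.
by rewrite mem_set.
Qed.

End PowerSeries.

(** * Weights under removal of the largest part *)

Definition odd_half_sum (s : seq nat) : nat :=
  (\sum_(i < size s | ~~ odd i) (nth 0 s i)./2)%N.

(* The weight with the roles of odd and even positions exchanged, as happens
   when the largest part is removed. *)
Definition shifted_term (s : seq nat) : fps int :=
  (-1) ^+ odd_sum s * fpsX ^+ (even_sum s + odd_half_sum s).

Lemma big_nth_even_cons (F : nat -> nat) x s :
  (\sum_(i < size (x :: s) | ~~ odd i) F (nth 0 (x :: s) i) =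
   F x + \sum_(i < size s | odd i) F (nth 0 s i))%N.
Proof.
rewrite big_mkcond big_ord_recl /= -big_mkcond /=.
by congr addn; apply: eq_bigl => i; rewrite negbK.
Qed.

Lemma big_nth_odd_cons (F : nat -> nat) x s :
  (\sum_(i < size (x :: s) | odd i) F (nth 0 (x :: s) i) =
   \sum_(i < size s | ~~ odd i) F (nth 0 s i))%N.
Proof. by rewrite big_mkcond big_ord_recl /= add0n -big_mkcond. Qed.

Lemma odd_sum_cons x s : odd_sum (x :: s) = (x + even_sum s)%N.
Proof. exact: (big_nth_even_cons id). Qed.

Lemma even_sum_cons x s : even_sum (x :: s) = odd_sum s.
Proof. exact: (big_nth_odd_cons id). Qed.

Lemma odd_half_sum_cons x s : odd_half_sum (x :: s) = (x./2 + even_half_sum s)%N.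
Proof. exact: (big_nth_even_cons half). Qed.

Lemma even_half_sum_cons x s : even_half_sum (x :: s) = odd_half_sum s.
Proof. exact: (big_nth_odd_cons half). Qed.

Lemma partition_term_nil : partition_term [::] = 1.
Proof.
by rewrite /partition_term /even_sum /odd_sum /even_half_sum !big_ord0 mul1r.
Qed.

Lemma shifted_term_nil : shifted_term [::] = 1.
Proof.
by rewrite /shifted_term /even_sum /odd_sum /odd_half_sum !big_ord0 mul1r.
Qed.

Lemma partition_term_cons x s :
  partition_term (x :: s) = fpsX ^+ x * shifted_term s.
Proof.
rewrite /partition_term odd_sum_cons even_sum_cons even_half_sum_cons.
by rewrite -addnA exprD mulrCA.
Qed.

Lemma shifted_term_cons x s :
  shifted_term (x :: s) = (-1) ^+ x * fpsX ^+ x./2 * partition_term s.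
Proof.
rewrite /shifted_term odd_sum_cons even_sum_cons odd_half_sum_cons.
by rewrite addnCA exprD [fpsX ^+ (_ + _)]exprD mulrACA.
Qed.

(** * Partitions as lists *)

Lemma is_partition_cons x s :
  is_partition (x :: s) = [&& (0 < x)%N, (head 0 s <= x)%N & is_partition s].
Proof.
rewrite /is_partition in_cons negb_or eq_sym -lt0n.
by case: s => [|y s] //=; case: ltnP => //=; rewrite ?andbF ?andbA.
Qed.

(** Strict descent replaces [uniq] so that prepending a part only requires a comparison with the
    head. *)
Definition is_strict_partition (s : seq nat) : bool :=
  sorted gtn s && (0%N \notin s).

Lemma is_strict_partitionE s : is_strict_partition s = is_partition s && uniq s.
Proof. by rewrite /is_strict_partition gtn_sorted_uniq_geq -andbA andbC. Qed.

Lemma is_strict_partition_cons x s : is_strict_partition (x :: s) =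
  [&& (0 < x)%N, (head 0 s < x)%N & is_strict_partition s].
Proof.
rewrite /is_strict_partition in_cons negb_or eq_sym -lt0n.
by case: s => [|y s] //=; case: (ltnP 0 x) => //=; rewrite ?andbF ?andbA.
Qed.

(** Every part is at least 1 and every other position counts. The two bounds are proved together
    because removing the head exchanges them. *)
Lemma size_partition (s : seq nat) : 0%N \notin s ->
  (size s <= (odd_sum s).*2)%N /\ (size s <= (even_sum s).*2.+1)%N.
Proof.
elim: s => [|x s IH]; first by [].
rewrite in_cons negb_or eq_sym -lt0n odd_sum_cons even_sum_cons /=.
by move=> /andP[x0 /IH[h1 h2]]; split; lia.
Qed.

Lemma head_le_odd_sum s : (head 0 s <= odd_sum s)%N.
Proof. by case: s => // x s; rewrite odd_sum_cons leq_addr. Qed.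

Lemma fcoef_partition_term_neq0 s n :
  fcoef (partition_term s) n <> 0 -> (odd_sum s <= n)%N.
Proof.
rewrite fcoef_signM fcoefXn; case: eqP => [-> _|_]; first exact: leq_addr.
by rewrite mulr0.
Qed.

(** Common shape of all the recurrences: [r1] holds the partitions with parts below x, [r2] the
    tails allowed after a largest part x. *)
Lemma big_cat_cons (F G : seq nat -> fps int) c x r1 r2 :
  (forall s, F (x :: s) = c * G s) ->
  \sum_(s <- r1 ++ map (cons x) r2) F s =
  \sum_(s <- r1) F s + c * \sum_(s <- r2) G s.
Proof.
move=> FG; rewrite big_cat big_map /= mulr_sumr; congr (_ + _).
by apply: eq_bigr => s _.
Qed.

Lemma uniq_cat_cons x (r1 r2 : seq (seq nat)) :
  {in r1, forall s, (head 0 s < x)%N} -> uniq r1 -> uniq r2 ->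
  uniq (r1 ++ map (cons x) r2).
Proof.
move=> r1x Ur1 Ur2; rewrite cat_uniq Ur1 map_inj_uniq ?Ur2 ?andbT /=; last first.
  by move=> s t [].
apply/hasPn => _ /mapP[s _ ->]; apply/negP => /r1x.
by rewrite ltnn.
Qed.

Lemma mem_cat_cons x r1 r2 (s : seq nat) :
  (s \in r1 ++ map (cons x) r2) =
  (s \in r1) || ((s != [::]) && (head 0 s == x) && (behead s \in r2)).
Proof.
rewrite mem_cat; congr orb; case: s => [|y s] /=; first by apply/negP => /mapP[].
apply/mapP/andP => [[t tr [-> ->]]|[/eqP-> sr]]; [by [] | by exists s].
Qed.

(** * Distinct parts *)

Fixpoint strict_partitions_le N : seq (seq nat) :=
  if N is N'.+1 then
    strict_partitions_le N' ++ map (cons N) (strict_partitions_le N')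
  else [:: [::]].

Lemma mem_strict_partitions_le N (s : seq nat) :
  (s \in strict_partitions_le N) = is_strict_partition s && (head 0 s <= N)%N.
Proof.
elim: N s => [|N IH] s.
  rewrite inE; case: s => [|x s] //=.
  by rewrite is_strict_partition_cons leqn0; case: x => // x; rewrite andbF.
rewrite /= mem_cat_cons !IH; case: s => [|x s] /=; first by [].
rewrite is_strict_partition_cons; case: (is_strict_partition s) => //=; lia.
Qed.

Lemma uniq_strict_partitions_le N : uniq (strict_partitions_le N).
Proof.
elim: N => //= N IH; apply: uniq_cat_cons => // s.
by rewrite mem_strict_partitions_le ltnS => /andP[].
Qed.

Lemma sum_strict_partitions_le k :
  \sum_(s <- strict_partitions_le k.*2.+1) partition_term s =
    qpoch_fin (- fpsX) (fpsX ^+ 3) k.+1 /\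
  \sum_(s <- strict_partitions_le k.*2.+1) shifted_term s = 0.
Proof.
have recA N : \sum_(s <- strict_partitions_le N.+1) partition_term s =
    \sum_(s <- strict_partitions_le N) partition_term s +
    fpsX ^+ N.+1 * \sum_(s <- strict_partitions_le N) shifted_term s.
  exact/big_cat_cons/partition_term_cons.
have recB N : \sum_(s <- strict_partitions_le N.+1) shifted_term s =
    \sum_(s <- strict_partitions_le N) shifted_term s + (-1) ^+ N.+1 *
    fpsX ^+ N.+1./2 * \sum_(s <- strict_partitions_le N) partition_term s.
  exact/big_cat_cons/shifted_term_cons.
elim: k => [|k [IHA IHB]].
  rewrite double0 recA recB !big_seq1 partition_term_nil shifted_term_nil.
  by rewrite qpoch_finS qpoch_fin0; split; rewrite /= ?expr0 ?expr1; ring.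
(* Two steps of the recurrence. As B_{2k+1} = 0, the first keeps A and gives B_{2k+2} = q^{k+1} A;
   the second cancels B and adds q^{(2k+3)+(k+1)} A, the new factor being 1 + q^{3(k+1)+1}. *)
rewrite doubleS (recA k.*2.+2) (recB k.*2.+2) (recA k.*2.+1) (recB k.*2.+1).
rewrite IHA IHB.
have sgn3 : (-1) ^+ k.*2.+3 = -1 :> fps int.
  by rewrite -signr_odd /= odd_double expr1.
have sgn2 : (-1) ^+ k.*2.+2 = 1 :> fps int.
  by rewrite -signr_odd /= odd_double expr0.
rewrite sgn2 sgn3.
rewrite /= uphalf_double doubleK !mulr0 !addr0 !add0r mulN1r mul1r mulNr subrr.
split=> //; rewrite (qpoch_finS _ _ k.+1) -exprM mulNr opprK mulrDr mulr1; congr (_ + _).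
by rewrite mulrA -exprD -exprS mulrC; congr (_ * fpsX ^+ _); lia.
Qed.

(** * Unrestricted partitions *)

(* The recursion on the length bound [l] makes the lists finite although parts
   may be repeated. *)
Fixpoint partitions_le (l : nat) : nat -> seq (seq nat) :=
  if l is l'.+1 then
    fix parts_le N :=
      if N is N'.+1 then parts_le N' ++ map (cons N) (partitions_le l' N)
      else [:: [::]]
  else fun=> [:: [::]].

Lemma partitions_leS l N : partitions_le l.+1 N.+1 =
  partitions_le l.+1 N ++ map (cons N.+1) (partitions_le l N.+1).
Proof. by []. Qed.

Lemma mem_partitions_le l N (s : seq nat) : (s \in partitions_le l N) =
  [&& is_partition s, (head 0 s <= N)%N & (size s <= l)%N].
Proof.
elim: l N s => [|l IHl] N s; first by rewrite inE; case: s => //= *; rewrite !andbF.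
elim: N s => [|N IH] s.
  rewrite inE; case: s => [|x s] //=.
  by rewrite is_partition_cons leqn0; case: x => // x; rewrite andbF.
rewrite partitions_leS mem_cat_cons IH IHl; case: s => [|x s] //=.
rewrite is_partition_cons; case: (is_partition s) => //=; lia.
Qed.

Lemma uniq_partitions_le l N : uniq (partitions_le l N).
Proof.
elim: l N => [|l IHl] // N; elim: N => // N IH.
rewrite partitions_leS; apply: uniq_cat_cons => // s.
by rewrite mem_partitions_le ltnS => /and3P[].
Qed.

(** Closed form of A_N; that of B_N follows. The lists agree with them only up to a degree set by
    the length bound, so the recurrences are checked on the closed forms. *)
Definition partition_sum_le N : fps int :=
  (qpoch_fin (fpsX ^+ 3) (fpsX ^+ 3) N./2)^-1.

Definition shifted_sum_le N : fps int :=
  if odd N then 0 else fpsX ^+ N./2 * partition_sum_le N.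

Lemma partition_sum_leS N : partition_sum_le N.+1 =
  partition_sum_le N + fpsX ^+ N.+1 * shifted_sum_le N.+1.
Proof.
rewrite /shifted_sum_le /partition_sum_le /=.
case: (boolP (odd N)) => oN /=; last by rewrite uphalf_half (negbTE oN) mulr0 addr0.
rewrite uphalf_half oN add1n qpoch_finS; set k := N./2.
have -> : N.+1 = k.+1.*2 by rewrite -[in LHS](odd_double_half N) oN.
set P := qpoch_fin _ _ _; set c := 1 - _.
have uP : P \is a GRing.unit by apply: qpoch_fin_unit; rewrite fcoefXn.
have uc : c \is a GRing.unit.
  by rewrite fps_unitE fcoefB fcoefM0 fcoefXn mul0r subr0 unitr1.
(* With N + 1 = 2(k+1) and c = 1 - q^{3k+3}, the claim is 1/P = (1 - q^{3k+3})/(P c) with the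
   subtracted term moved across. *)
have -> : P^-1 = c * (P * c)^-1 by rewrite invrM // mulVKr.
rewrite {2}/c mulrBl mul1r mulrA -exprM -!exprD.
by rewrite (_ : (3 + 3 * k = k.+1.*2 + k.+1)%N) ?subrK //; lia.
Qed.

Lemma shifted_sum_leS N : shifted_sum_le N.+1 =
  shifted_sum_le N + (-1) ^+ N.+1 * fpsX ^+ N.+1./2 * partition_sum_le N.+1.
Proof.
rewrite /shifted_sum_le /partition_sum_le -signr_odd /= uphalf_half.
by case: (odd N); rewrite /= ?expr0 ?expr1 ?mul1r ?add0r // mulN1r mulNr subrr.
Qed.

Lemma fcoef0_partition_sum_le N : fcoef (partition_sum_le N) 0 = 1.
Proof.
have a0 : fcoef (fpsX ^+ 3 : fps int) 0 = 0 by rewrite fcoefXn.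
rewrite -[LHS]mulr1 -[X in _ * X](@fcoef0_qpoch_fin _ _ (fpsX ^+ 3) N./2 a0).
by rewrite -fcoefM0 mulVr // qpoch_fin_unit.
Qed.

Lemma partition_sum_le0 : partition_sum_le 0 = 1.
Proof. by rewrite /partition_sum_le qpoch_fin0 invr1. Qed.

(** Partitions longer than l affect A only in degrees above l/2, and B only in degrees at least l/2.
    The strict inequality for B drives the induction: removing a part from A lowers the degree by at
    least 1, whereas removing a part 1 from B lowers only the length. *)
Lemma fcoef_partitions_le l N n :
  ((n.*2 <= l)%N -> fcoef (\sum_(s <- partitions_le l N) partition_term s) n =
                    fcoef (partition_sum_le N) n) /\
  ((n.*2 < l)%N -> fcoef (\sum_(s <- partitions_le l N) shifted_term s) n =
                   fcoef (shifted_sum_le N) n).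
Proof.
elim: l N n => [|l IHl] N n.
  split=> //; rewrite leqn0 double_eq0 => /eqP->.
  by rewrite big_seq1 partition_term_nil fcoef0_partition_sum_le.
elim: N n => [|N IHN] n.
  rewrite !big_seq1 partition_term_nil shifted_term_nil.
  by rewrite /shifted_sum_le mul1r partition_sum_le0.
rewrite partitions_leS (big_cat_cons _ _ (partition_term_cons _)).
rewrite (big_cat_cons _ _ (shifted_term_cons _)) !fcoefD.
have [IHA IHB] := IHN n; split=> ln.
  rewrite IHA // partition_sum_leS fcoefD !fcoefXnM; congr (_ + _).
  by case: ltnP => // Nn; apply: (proj2 (IHl _ _)); lia.
rewrite IHB // shifted_sum_leS fcoefD -!mulrA !fcoef_signM !fcoefXnM.
congr (_ + _ * _).
by case: ltnP => // Nn; apply: (proj1 (IHl _ _)); lia.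
Qed.

Theorem theorem4p7 :
  fps_has_sum distinct_partitions partition_term (qpoch (- fpsX) (fpsX ^+ 3))
  /\
  fps_has_sum partitions partition_term (qpoch (fpsX ^+ 3) (fpsX ^+ 3))^-1.
Proof.
have X3 : fcoef (fpsX ^+ 3 : fps int) 0 = 0 by rewrite fcoefXn.
split; apply: fps_has_sum_seq => n.
  have [K hK] := qpoch_cvg (- fpsX) X3 n.
  (* The bound exceeds n, so all contributing partitions are listed, and the product has more than K
     factors, so its coefficient n is final. *)
  exists (strict_partitions_le (maxn K n).*2.+1); split.
  - exact: uniq_strict_partitions_le.
  - by move=> s; rewrite mem_strict_partitions_le is_strict_partitionE => /andP[].
  - move=> s Ds /fcoef_partition_term_neq0 sn.
    rewrite mem_strict_partitions_le is_strict_partitionE Ds /=.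
    by have := head_le_odd_sum s; lia.
  - by rewrite (sum_strict_partitions_le _).1 hK //; lia.
have [K hK] := qpochV_cvg X3 X3 n.
(* A contributing partition has [odd_sum] at most n, hence at most 2n parts, each at most n; length
   2n is also just enough for [fcoef_partitions_le]. *)
exists (partitions_le n.*2 (maxn K n).*2); split.
- exact: uniq_partitions_le.
- by move=> s; rewrite mem_partitions_le => /andP[].
- move=> s Ps /fcoef_partition_term_neq0 sn; rewrite mem_partitions_le.
  have /andP[_ /size_partition[h _]] : is_partition s := Ps.
  by rewrite (Ps : is_partition s) /=; have := head_le_odd_sum s; lia.
- rewrite (fcoef_partitions_le _ _ _).1 // /partition_sum_le doubleK.
  by apply: hK; lia.
Qed.
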